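(* Finding a constant approximation of the minimum vertex cover of $n$-vertex stochastic bipartite graphs with realization probability $p$ requires $\Omega(n/p)$ total queries. That is, for any constant $c>1$ there are $n$-vertex bipartite graphs $G$ such that any algorithm outputting a $c$-approximate vertex cover of $G_p$ must query $\Omega(n/p)$ edges.
   Context: $G_p$ is the random subgraph of a given graph $G$ containing each edge independently with probability $p$. An algorithm non-adaptively chooses edges of $G$ to query, learns which queried edges are in $G_p$, and outputs a set $C$ of vertices that is a vertex cover of $G_p$ with probability $1$ (in particular every non-queried edge must be covered); it is $c$-approximate if $\mathbb{E}|C|\le c\,\mathbb{E}[\nu(G_p)]$, where $\nu$ denotes minimum vertex cover size.
   Formalization: The realization probability is restricted to eps/n ≤ p ≤ p0 for arbitrary eps > 0 and p0 < 1/c, with the Ω-constant depending on c, eps, p0; for p ≥ 1/c zero queries suffice on bipartite graphs, and for p = o(1/n) there are too few edges, so the claim fails there. *)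

(* Defs.v *)
From HB Require Import structures.
From mathcomp Require Import all_boot all_order all_algebra.
From mathcomp Require Import reals.

Set Implicit Arguments.
Unset Strict Implicit.
Unset Printing Implicit Defensive.

Import Order.TTheory GRing.Theory Num.Theory.
Local Open Scope ring_scope.

(* A graph on the vertex set [T] is given by its set of edges, each edge being
   a 2-element set of vertices. *)

Definition simple_graph (T : finType) (G : {set {set T}}) : Prop :=
  forall e, e \in G -> #|e| = 2%N.

Definition bipartite (T : finType) (G : {set {set T}}) : Prop :=
  exists L : {set T}, forall e, e \in G -> #|e :&: L| = 1%N /\ #|e :\: L| = 1%N.

Definition vertex_cover (T : finType) (G : {set {set T}}) (C : {set T}) : bool :=
  [forall e in G, ~~ [disjoint e & C]].

(* The default value [#|T|] is the size of the trivial cover [setT]. *)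
Definition vc_number (T : finType) (G : {set {set T}}) : nat :=
  \big[minn/#|T|]_(C : {set T} | vertex_cover G C) #|C|.

Definition realization_prob (R : realType) (T : finType) (p : R)
    (G H : {set {set T}}) : R :=
  p ^+ #|H| * (1 - p) ^+ #|G :\: H|.

Definition expect_realization (R : realType) (T : finType) (p : R)
    (G : {set {set T}}) (X : {set {set T}} -> R) : R :=
  \sum_(H in powerset G) realization_prob p G H * X H.

(* A deterministic non-adaptive algorithm for a fixed graph: a set of queried
   edges, and a map from the set of queried edges found to be realized to the
   output set of vertices. *)
Definition det_algorithm (T : finType) : finType :=
  ({set {set T}} * {ffun {set {set T}} -> {set T}})%type.

Definition queries (T : finType) (A : det_algorithm T) : {set {set T}} := A.1.

Definition output (T : finType) (A : det_algorithm T) (H : {set {set T}}) :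
    {set T} := A.2 (H :&: queries A).

(* A randomized algorithm is a distribution on deterministic ones, drawn
   independently of the realization. Since [det_algorithm T] is finite, every
   source of internal randomness induces a distribution of this form. *)
Definition algorithm (R : realType) (T : finType) (G : {set {set T}})
    (mu : {ffun det_algorithm T -> R}) : Prop :=
  [/\ forall A, 0 <= mu A,
      \sum_A mu A = 1
    & forall A, mu A != 0 -> queries A \subset G].

Definition expect_algorithm (R : realType) (T : finType)
    (mu : {ffun det_algorithm T -> R}) (X : det_algorithm T -> R) : R :=
  \sum_A mu A * X A.

Definition covers_almost_surely (R : realType) (T : finType) (p : R)
    (G : {set {set T}}) (mu : {ffun det_algorithm T -> R}) : Prop :=
  expect_algorithm mu (fun A =>
    expect_realization p G (fun H => (vertex_cover H (output A H))%:R)) = 1.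

Definition approximate (R : realType) (T : finType) (p c : R)
    (G : {set {set T}}) (mu : {ffun det_algorithm T -> R}) : Prop :=
  expect_algorithm mu (fun A =>
    expect_realization p G (fun H => #|output A H|%:R))
  <= c * expect_realization p G (fun H => (vc_number H)%:R).

Definition expected_queries (R : realType) (T : finType)
    (mu : {ffun det_algorithm T -> R}) : R :=
  expect_algorithm mu (fun A => #|queries A|%:R).

(* Range of [p] in a lower bound of order [n / p] for factor [c]. A bipartite
   graph has at most [n ^ 2 / 4] edges, so [p] must be at least of order
   [1 / n]. If [c * p >= 1], then outputting a minimum vertex cover of the whole
   graph without any query is already [c]-approximate (by Koenig's theorem), so
   [p] must stay below [1 / c]. Both thresholds, [eps / n] and [p0 < 1 / c],
   are arbitrary. *)
Definition admissible_prob (R : realType) (n : nat) (eps p0 p : R) : Prop :=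
  0 < p /\ eps / n%:R <= p <= p0.

(* Main.v *)
(* Take [G] to be a [d]-regular bipartite graph with [k = n./2] vertices on each
   side and [d] about [p0 / p] (capped at [k]). Choosing one endpoint of each
   realized edge gives a cover of [G_p] of expected size at most
   [p * (k * d) <= p0 * k], so the output has expected size at most
   [c * p0 * k], where [c * p0 < 1]. But the output must cover all unqueried
   edges, and each of its vertices covers at most [d] of the [k * d] edges, so
   at least [(1 - c * p0) * k * d] edges are queried in expectation; this is of
   order [n / p]. *)

Require Import Defs.
From HB Require Import structures.
From mathcomp Require Import all_boot all_order all_algebra.
From mathcomp Require Import reals.
From mathcomp Require Import archimedean ring lra zify.

Set Implicit Arguments.
Unset Strict Implicit.
Unset Printing Implicit Defensive.

Import Order.TTheory GRing.Theory Num.Theory.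
Local Open Scope ring_scope.

(** * Expectations over the random subgraph *)

(** Expanding the product chooses [a i] or [b i] for each [i]. This is the tool that factorizes sums
    over realizations into independent edges. *)
Lemma prod_sum_subsets (R : comPzRingType) (I : finType) (G : {set I})
    (a b : I -> R) :
  \sum_(H in powerset G) (\prod_(i in H) a i) * (\prod_(i in G :\: H) b i) =
  \prod_(i in G) (a i + b i).
Proof.
(* Extending [a] by 0 and [b] by 1 outside [G] turns this into a product over the whole type, where
   every [H] not contained in [G] contributes 0. *)
pose a' i := if i \in G then a i else 0.
pose b' i := if i \in G then b i else 1.
have -> : \prod_(i in G) (a i + b i) = \prod_i (a' i + b' i).
  rewrite big_mkcond; apply: eq_bigr => i _; rewrite /a' /b'.
  by case: ifP; rewrite ?add0r.
rewrite bigA_distr big_mkcond; apply: eq_bigr => H _; rewrite powersetE.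
case: ifPn => [/subsetP sHG | /subsetPn [i iH iNG]]; last first.
  by rewrite (bigD1 i) //= iH /a' (negPf iNG) mul0r.
rewrite [in LHS]big_mkcond [X in _ * X]big_mkcond -big_split.
apply: eq_bigr => i _; rewrite inE /a' /b'.
case: ifPn => [/sHG -> | _] /=; first by rewrite mulr1.
by rewrite mul1r.
Qed.

Lemma realization_prob_sum1 (R : realType) (T : finType) (p : R)
    (G : {set {set T}}) :
  \sum_(H in powerset G) realization_prob p G H = 1.
Proof.
transitivity (\prod_(e in G) (p + (1 - p))).
  by rewrite -prod_sum_subsets; apply: eq_bigr => H _; rewrite !prodr_const.
by rewrite big1 // => e _; rewrite addrC subrK.
Qed.

(** Replacing the weight [1 - p] of the absence of [e] by 0 encodes the indicator of [e \in H]. In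
    the factorized sum, [e] then gives [p] and every other edge gives 1. *)
Lemma expect_edge_realized (R : realType) (T : finType) (p : R)
    (G : {set {set T}}) (e : {set T}) :
  e \in G -> expect_realization p G (fun H => (e \in H)%:R) = p.
Proof.
move=> eG; pose b f := if f == e then 0 else 1 - p.
transitivity (\prod_(f in G) (p + b f)).
  rewrite -prod_sum_subsets; apply: eq_bigr => H _; rewrite prodr_const.
  rewrite /realization_prob -mulrA; congr (_ * _).
  case: (boolP (e \in H)) => [eH | eNH]; last first.
    by rewrite mulr0 (bigD1 e) ?inE ?eNH //= /b eqxx mul0r.
  rewrite mulr1 -prodr_const; apply: eq_bigr => f; rewrite inE => /andP[fNH _].
  by rewrite /b; case: eqP fNH => // ->; rewrite eH.
rewrite (bigD1 e) //= /b eqxx addr0 big1 ?mulr1 // => f /andP[_ /negPf ->].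
by rewrite addrC subrK.
Qed.

Lemma expect_card_realization (R : realType) (T : finType) (p : R)
    (G : {set {set T}}) :
  expect_realization p G (fun H => #|H|%:R) = p * #|G|%:R.
Proof.
transitivity (\sum_(e in G) expect_realization p G (fun H => (e \in H)%:R)).
  rewrite exchange_big /=; apply: eq_bigr => H; rewrite powersetE => sHG.
  rewrite -big_distrr; congr (_ * _).
  rewrite -sum1_card natr_sum big_mkcond [RHS]big_mkcond /=.
  apply: eq_bigr => e _; case: (boolP (e \in H)) => [/(subsetP sHG) -> // | _].
  by case: ifP.
rewrite (eq_bigr (fun=> p)) => [|e]; last exact: expect_edge_realized.
by rewrite sumr_const mulr_natr.
Qed.

Lemma realization_prob_gt0 (R : realType) (T : finType) (p : R)
    (G H : {set {set T}}) : 0 < p < 1 -> 0 < realization_prob p G H.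
Proof.
by case/andP=> p0 p1; rewrite mulr_gt0 // exprn_gt0 // subr_gt0.
Qed.

(** The nonnegative terms [w i * (1 - x i)] sum to 0, so each of them vanishes. *)
Lemma weighted_average_eq1 (R : realType) (I : finType) (P : pred I)
    (w x : I -> R) :
  (forall i, P i -> 0 <= w i) -> (forall i, P i -> x i <= 1) ->
  \sum_(i | P i) w i = 1 -> \sum_(i | P i) w i * x i = 1 ->
  forall i, P i -> w i != 0 -> x i = 1.
Proof.
move=> w0 x1 sw swx i Pi wi.
have /psumr_eq0P E : \sum_(j | P j) w j * (1 - x j) = 0.
  rewrite (eq_bigr (fun j => w j - w j * x j)) => [|j _]; last by ring.
  by rewrite sumrB sw swx subrr.
have /eqP : w i * (1 - x i) = 0.
  by apply: E => // j Pj; rewrite mulr_ge0 ?w0 // subr_ge0 x1.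
by rewrite mulf_eq0 (negPf wi) subr_eq0 => /eqP.
Qed.

(** * Size bounds for vertex covers *)

Lemma vc_number_le (T : finType) (H : {set {set T}}) (C : {set T}) :
  vertex_cover H C -> (vc_number H <= #|C|)%N.
Proof.
by move=> HC; rewrite /vc_number -minEnat -leEnat; apply: bigmin_le_cond.
Qed.

Lemma card_bigcup_le (I T : finType) (A : {pred I}) (F : I -> {set T}) :
  (#|\bigcup_(i in A) F i| <= \sum_(i in A) #|F i|)%N.
Proof.
elim/big_ind2: _ => [|B m C n hB hC|//]; first by rewrite cards0.
by rewrite (leq_trans (leq_card_setU _ _)) // leq_add.
Qed.

(** One endpoint per edge forms a cover; every edge has one because [set0] is not an edge. *)
Lemma vc_number_le_card (T : finType) (H : {set {set T}}) :
  set0 \notin H -> (vc_number H <= #|H|)%N.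
Proof.
move=> H0; pose f (e : {set T}) := oapp (fun v => [set v]) set0 [pick v in e].
apply: (@leq_trans #|\bigcup_(e in H) f e|).
  apply/vc_number_le/forall_inP => e eH; apply/pred0Pn.
  have [v ve fe] : exists2 v, v \in e & f e = [set v].
    rewrite /f; case: pickP => [v ve | e0]; first by exists v.
    by case/negP: H0; rewrite (_ : set0 = e) //; apply/setP => v; rewrite inE e0.
  exists v; rewrite /= ve; apply/bigcupP; exists e => //.
  by rewrite fe set11.
apply: leq_trans (card_bigcup_le _ _) _; rewrite -sum1_card leq_sum // => e _.
by rewrite /f; case: pickP => [v _|_] /=; rewrite ?cards1 ?cards0.
Qed.

(** The edges are covered by the stars of the vertices of [C], each of size at most [d]. *)
Lemma card_covered_edges (T : finType) (G : {set {set T}}) (C : {set T})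
    (d : nat) :
  (forall v, #|[set e in G | v \in e]| <= d)%N -> vertex_cover G C ->
  (#|G| <= #|C| * d)%N.
Proof.
move=> deg /forall_inP cov.
have sub : G \subset \bigcup_(v in C) [set e in G | v \in e].
  apply/subsetP => e eG; have /pred0Pn[v /= /andP[ve vC]] := cov e eG.
  by apply/bigcupP; exists v => //; rewrite inE eG.
apply: leq_trans (subset_leq_card sub) _; rewrite -sum_nat_const.
by apply: leq_trans (card_bigcup_le _ _) _; apply: leq_sum.
Qed.

(** * Query lower bound in a graph of bounded degree *)

(** An average of values at most 1 equals 1 only if every value of nonzero weight is 1. This is
    applied first to [mu], then to the realizations, which all have positive probability. *)
Lemma covers_almost_surely_sure (R : realType) (T : finType) (p : R)
    (G : {set {set T}}) (mu : {ffun det_algorithm T -> R}) :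
  0 < p < 1 -> algorithm G mu -> covers_almost_surely p G mu ->
  forall A, mu A != 0 ->
  forall H : {set {set T}}, H \subset G -> vertex_cover H (output A H).
Proof.
move=> hp [mu0 mu1 _] cov A muA H sHG.
have le1 (b : bool) : b%:R <= 1 :> R by case: b.
have E : expect_realization p G
    (fun H => (vertex_cover H (output A H))%:R) = 1.
  apply: (weighted_average_eq1 (P := predT) _ _ mu1 cov) => // B _.
  rewrite -[leRHS](realization_prob_sum1 p G); apply: ler_sum => K _.
  by rewrite ler_piMr // ltW // realization_prob_gt0.
have := weighted_average_eq1 (fun K _ => ltW (realization_prob_gt0 G K hp))
  (fun K _ => le1 _) (realization_prob_sum1 p G) E.
move=> /(_ H); rewrite powersetE sHG gt_eqF ?realization_prob_gt0 //.
by move=> /(_ isT isT) /eqP; rewrite pnatr_eq1; case: vertex_cover.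
Qed.

(* The output on [H] is also the output on [H] together with all unqueried
   edges, hence it covers every unqueried edge. *)
Lemma output_covers_unqueried (T : finType) (G : {set {set T}})
    (A : det_algorithm T) :
  (forall H : {set {set T}}, H \subset G -> vertex_cover H (output A H)) ->
  forall H : {set {set T}}, H \subset G -> vertex_cover (G :\: queries A) (output A H).
Proof.
move=> cov H sHG.
have := cov ((H :&: queries A) :|: (G :\: queries A)).
have -> : output A (H :&: queries A :|: G :\: queries A) = output A H.
  congr (A.2 _); apply/setP => e; rewrite !inE.
  by case: (e \in queries A); rewrite ?andbF ?orbF ?andbT.
move/(_ _)/forall_inP => C; apply/forall_inP => e eGQ; apply: C.
  rewrite subUset subsetDl andbT; apply: subset_trans sHG.
  exact: subsetIl.
by rewrite inE eGQ orbT.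
Qed.

(** Unqueried edges number at most [d] times the output size, whose expectation is at most
    [c * p * #|G|] because the cover number of a realization is at most its number of edges. *)
Lemma expected_queries_ge (R : realType) (T : finType) (p c : R) (d : nat)
    (G : {set {set T}}) (mu : {ffun det_algorithm T -> R}) :
  0 < p < 1 -> 0 <= c -> set0 \notin G ->
  (forall v, #|[set e in G | v \in e]| <= d)%N ->
  algorithm G mu -> covers_almost_surely p G mu -> approximate p c G mu ->
  #|G|%:R * (1 - c * p * d%:R) <= expected_queries mu.
Proof.
move=> hp c0 G0 deg alg cov app.
have sure := covers_almost_surely_sure hp alg cov.
case: alg => mu0 mu1 _.
pose out A := expect_realization p G (fun H => #|output A H|%:R).
have vc : expect_realization p G (fun H => (vc_number H)%:R) <= p * #|G|%:R.
  rewrite -expect_card_realization; apply: ler_sum => H; rewrite powersetE => s.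
  rewrite ler_wpM2l ?(ltW (realization_prob_gt0 _ _ _)) // ler_nat.
  by apply: vc_number_le_card; apply: contra G0; apply: (subsetP s).
(* For a fixed [A], the bound holds on each realization and is then averaged with the weights
   [realization_prob]. *)
have main A : mu A != 0 -> #|G|%:R <= #|queries A|%:R + d%:R * out A.
  move=> muA; rewrite -lerBlDl.
  rewrite -[leLHS]mul1r -[X in X * _ <= _](realization_prob_sum1 p G) big_distrl big_distrr /=.
  apply: ler_sum => H; rewrite powersetE => s.
  rewrite mulrCA ler_wpM2l ?(ltW (realization_prob_gt0 _ _ _)) // lerBlDl.
  rewrite -natrM -natrD ler_nat mulnC.
  apply: leq_trans (leq_add (leqnn _) (card_covered_edges _
    (output_covers_unqueried (sure A muA) s))).
    rewrite -(cardsID (queries A) G) leq_add2r subset_leq_card //.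
    exact: subsetIr.
  move=> v; apply: leq_trans (deg v); apply: subset_leq_card.
  by apply/subsetP => e; rewrite !inE => /andP[/andP[_ ->]].
have avg : #|G|%:R <= expected_queries mu + d%:R * expect_algorithm mu out.
  rewrite -[leLHS]mul1r -[X in X * _ <= _]mu1 big_distrl big_distrr -big_split /=.
  apply: ler_sum => A _; have [->|muA] := eqVneq (mu A) 0.
    by rewrite !mul0r mulr0 addr0.
  by rewrite mulrCA -mulrDr ler_wpM2l // main.
have : d%:R * expect_algorithm mu out <= d%:R * (c * (p * #|G|%:R)).
  apply: ler_wpM2l; first exact: ler0n.
  by apply: le_trans app _; apply: ler_wpM2l.
lra.
Qed.

(** * Regular bipartite graphs from a finite abelian group *)

Section CayleyGraph.

Variables (T : finType) (K : finZmodType) (D : {set K}) (l r : K -> T).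
Hypotheses (l_inj : injective l) (r_inj : injective r).
Hypothesis lNr : forall i j, l i != r j.

(** The pair [x] consists of a left index and a shift. Parametrizing edges by shifts makes the
    degree bound and the edge count immediate. *)
Definition cayley_edge (x : K * K) : {set T} := [set l x.1; r (x.1 + x.2)].

Definition cayley_graph : {set {set T}} :=
  [set cayley_edge x | x in setX [set: K] D].

Lemma mem_cayley_edge_l x i : (l i \in cayley_edge x) = (i == x.1).
Proof. by rewrite !inE (negPf (lNr _ _)) orbF (inj_eq l_inj). Qed.

Lemma mem_cayley_edge_r x j : (r j \in cayley_edge x) = (j == x.1 + x.2).
Proof. by rewrite !inE eq_sym (negPf (lNr _ _)) (inj_eq r_inj). Qed.

(** The left endpoint determines the index, and the right endpoint then determines the shift by
    cancellation. *)
Lemma cayley_edge_inj : injective cayley_edge.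
Proof.
move=> [i j] [i' j'] E.
have /eqP /= ii : i == i' by rewrite -(mem_cayley_edge_l (i', j')) -E set21.
have : r (i + j) \in cayley_edge (i', j') by rewrite -E set22.
by rewrite mem_cayley_edge_r ii => /eqP /addrI ->.
Qed.

Lemma card_cayley_graph : #|cayley_graph| = (#|K| * #|D|)%N.
Proof. by rewrite card_imset ?cardsX ?cardsT //; apply: cayley_edge_inj. Qed.

Lemma cayley_graph_simple : simple_graph cayley_graph.
Proof. by move=> _ /imsetP[x _ ->]; rewrite cards2 lNr. Qed.

Lemma cayley_graph_bipartite : bipartite cayley_graph.
Proof.
exists [set l i | i : K] => _ /imsetP[x _ ->].
have lL i : l i \in [set l i | i : K] by apply: imset_f.
have rNL i : r i \notin [set l i | i : K].
  by apply/imsetP => -[j _ E]; have := lNr j i; rewrite E eqxx.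
split; apply/eqP/cards1P; [exists (l x.1)|exists (r (x.1 + x.2))].
  apply/setP => v; rewrite !inE; case: (v =P l _) => [->|_]; first exact: lL.
  by case: eqP => [->|] //; rewrite (negPf (rNL _)) andbF.
apply/setP => v; rewrite !inE; case: (v =P r _) => [->|_].
  by rewrite rNL orbT.
by case: eqP => [->|]; rewrite ?lL ?andbF.
Qed.

(* For a fixed shift [j] exactly one edge [(i, j)] meets a given vertex. *)
Lemma cayley_graph_degree v : (#|[set e in cayley_graph | v \in e]| <= #|D|)%N.
Proof.
pose S := [set x in setX [set: K] D | v \in cayley_edge x].
have -> : [set e in cayley_graph | v \in e] = cayley_edge @: S.
  apply/setP => e; rewrite inE; apply/andP/imsetP.
    by case=> /imsetP[x xD ->] ve; exists x => //; rewrite inE xD.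
  by case=> x; rewrite inE => /andP[xD ve] ->; split=> //; apply: imset_f.
rewrite card_imset; last exact: cayley_edge_inj.
rewrite -(@card_in_imset _ _ snd (mem S)).
  apply: subset_leq_card; apply/subsetP => _ /imsetP[x + ->].
  by rewrite !inE => /andP[].
move=> [i j] [i' j']; rewrite !inE /= => /andP[_ h] /andP[_ h'] jj.
subst j'; congr (_, _); case/orP: h h' => /eqP ->.
  by rewrite (negPf (lNr _ _)) orbF (inj_eq l_inj) => /eqP.
by rewrite eq_sym (negPf (lNr _ _)) (inj_eq r_inj) => /eqP /addIr.
Qed.

End CayleyGraph.

(** The group is the integers modulo [k], with the first [d] residues as shifts. The sides are the
    first [k] vertices and the next [k]; any others stay isolated. *)
Lemma regular_bipartite_graph_exists (n k d : nat) :
  (k.*2 <= n)%N -> (0 < d <= k)%N ->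
  exists G : {set {set 'I_n}},
    [/\ simple_graph G, bipartite G, #|G| = (k * d)%N
      & forall v, (#|[set e in G | v \in e]| <= d)%N].
Proof.
case: k => [|k]; first by case: d.
move=> kn /andP[_ dk].
have kn' : (k.+1 + k.+1 <= n)%N by rewrite addnn.
pose l (i : 'I_k.+1) := widen_ord kn' (lshift k.+1 i).
pose r (i : 'I_k.+1) := widen_ord kn' (rshift k.+1 i).
have l_inj : injective l by move=> i j /(congr1 val) /= /val_inj.
have r_inj : injective r by move=> i j /(congr1 val) /= /addnI /val_inj.
have lNr i j : l i != r j.
  by rewrite -val_eqE /= neq_ltn (leq_trans (ltn_ord i)) // leq_addr.
pose D := [set widen_ord dk i | i : 'I_d].
have cD : #|D| = d.
  rewrite card_imset ?card_ord // => i j /(congr1 val) /= /val_inj //.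
exists (cayley_graph D l r); split.
- exact: cayley_graph_simple.
- exact: cayley_graph_bipartite.
- by rewrite card_cayley_graph // cD card_ord.
- by move=> v; rewrite -[leqRHS]cD; apply: cayley_graph_degree.
Qed.

(** * Choice of constants and the final bound *)

Theorem theorem7p5 (R : realType) (c : R) (hc : 1 < c)
    (eps : R) (heps : 0 < eps) (p0 : R) (hp0 : p0 < c^-1) :
  exists2 a : R, 0 < a &
  exists n0 : nat, forall (n : nat) (p : R),
    (n0 <= n)%N -> admissible_prob n eps p0 p ->
    exists G : {set {set 'I_n}},
      [/\ simple_graph G,
          bipartite G
        & forall mu : {ffun det_algorithm 'I_n -> R},
            algorithm G mu ->
            covers_almost_surely p G mu ->
            approximate p c G mu ->
            a * (n%:R / p) <= expected_queries mu].

Proof.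
have ic1 : c^-1 < 1 by rewrite invf_lt1 //; apply: lt_trans hc.
have c0 : 0 < c by apply: lt_trans hc.
(* For [p0 <= 0] no [p] is admissible, so any constant works. *)
have [p0_le0|p0_gt0] := leP p0 0.
  exists 1 => //; exists 0%N => n p _ [p_gt0 /andP[_ p_le]].
  by have := lt_le_trans p_gt0 (le_trans p_le p0_le0); rewrite ltxx.
have cp0 : 0 < 1 - c * p0 by rewrite subr_gt0 -ltr_pdivlMl // mulr1.
(* Chosen so that [b / p <= d]: [p0 / 2] absorbs the rounding of [p0 / p], and [eps / 4] handles the
   cap [d = k]. *)
pose b := Num.min (p0 / 2) (eps / 4).
have b_gt0 : 0 < b by rewrite lt_min !divr_gt0.
(* The factor 1/4 comes from [k >= n / 4], and [1 - c * p0] bounds from below the fraction of edges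
   queried. *)
exists (b / 4 * (1 - c * p0)); first by rewrite mulr_gt0 ?divr_gt0.
exists 2%N => n p n2 [p_gt0 /andP[p_ge p_le]].
have n_gt0 : 0 < n%:R :> R by rewrite ltr0n (ltn_trans _ n2).
pose k := n./2; pose d := minn (Num.trunc (p0 / p)) k.
have x_ge1 : 1 <= p0 / p by rewrite ler_pdivlMr // mul1r.
have x_ge0 : 0 <= p0 / p by apply: le_trans x_ge1.
have dk : (0 < d <= k)%N by rewrite geq_minr leq_min truncn_gt0 x_ge1 half_gt0 n2.
have [|G [sG bG cG deg]] := regular_bipartite_graph_exists (n := n) _ dk.
  by rewrite -[leqRHS]odd_double_half leq_addl.
exists G; split=> // mu alg cov app.
have p_lt1 : 0 < p < 1.
  by rewrite p_gt0 (le_lt_trans p_le) // (lt_trans hp0).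
have G0 : set0 \notin G by apply/negP => /sG; rewrite cards0.
apply: le_trans (expected_queries_ge p_lt1 (ltW c0) G0 deg alg cov app).
have k_ge : n%:R / 4 <= k%:R :> R.
  rewrite ler_pdivrMr // -natrM ler_nat /k; clear -n2; lia.
have pd_le : p * d%:R <= p0.
  rewrite mulrC -ler_pdivlMr //; apply: le_trans (_ : (Num.trunc (p0 / p))%:R <= _).
    by rewrite ler_nat geq_minl.
  by rewrite truncn_le.
have d_ge : b / p <= d%:R.
  rewrite /d; case: (leqP (Num.trunc (p0 / p)) k) => _.
    apply: le_trans (_ : p0 / 2 / p <= _).
      by rewrite ler_pM2r ?invr_gt0 // ge_min lexx.
    (* With [t] the truncation of [x = p0 / p], [x < t + 1 <= 2 * t] since [t >= 1], hence
       [x / 2 <= t]. *)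
    have := truncnS_gt (p0 / p).
    have : 1 <= (Num.trunc (p0 / p))%:R :> R by rewrite ler1n truncn_gt0.
    rewrite -natr1 (mulrAC p0); lra.
  (* In the capped case [eps / n <= p] gives [b / p <= n / 4 <= k]. *)
  apply: le_trans k_ge; rewrite ler_pdivrMr //.
  apply: le_trans (_ : eps / 4 <= _); first by rewrite ge_min lexx orbT.
  move: p_ge; rewrite ler_pdivrMr //; lra.
have bp_ge0 : 0 <= b / p by rewrite divr_ge0 ?ltW.
rewrite cG natrM.
apply: le_trans (_ : k%:R * d%:R * (1 - c * p0) <= _).
  rewrite mulrAC ler_pM2r //.
  have -> : b / 4 * (n%:R / p) = n%:R / 4 * (b / p) by field; rewrite gt_eqF.
  by rewrite ler_pM // divr_ge0.
by rewrite ler_wpM2l ?mulr_ge0 // lerD2l lerN2 -mulrA ler_wpM2l // ltW.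
Qed.
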